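(* Let $t:(\mathcal M',\mathcal W')\to(\mathcal M,\mathcal W)$ be a left approximation functor, or a right approximation functor, of category pairs. Then $t$ induces an equivalence of homotopy categories $\mathbf{ho}t:\mathbf{ho}\mathcal M'\to\mathbf{ho}\mathcal M$.
   Context: A category pair $(\mathcal M,\mathcal W)$ is a category $\mathcal M$ with a class $\mathcal W$ of maps (weak equivalences) stable under composition and containing all identity maps. $\mathbf{ho}\mathcal M=\mathcal M[\mathcal W^{-1}]$ is the localization of $\mathcal M$ at $\mathcal W$. A category pair functor $t:(\mathcal M',\mathcal W')\to(\mathcal M,\mathcal W)$ is a functor $t:\mathcal M'\to\mathcal M$ with $t(\mathcal W')\subset\mathcal W$; it induces $\mathbf{ho}t:\mathbf{ho}\mathcal M'\to\mathbf{ho}\mathcal M$. $t$ is a left approximation if: LAP1: for any object $A\in\mathcal M$ there are an object $A'\in\mathcal M'$ and a weak equivalence $tA'\to A$. LAP2: for any objects $A',B'\in\mathcal M'$, $B\in\mathcal M$, any map $f:tA'\to B$ in $\mathcal M$ and any $p:tB'\to B$ in $\mathcal W$: (1) there exist maps $i':A'\to D'$ and $j':B'\to D'$ in $\mathcal M'$ with $j'\in\mathcal W'$, and a weak equivalence $\sigma:tD'\to B$ in $\mathcal W$, with $\sigma\circ ti'=f$ and $\sigma\circ tj'=p$; (2) for any other such $i'',j'',\sigma''$ (with some object $D''$), one has $j'^{-1}i'=j''^{-1}i''$ in $\mathbf{ho}\mathcal M'$. $t$ is a right approximation if the dual conditions hold: RAP1: for any $A\in\mathcal M$ there are $A'\in\mathcal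 M'$ and a weak equivalence $A\to tA'$. RAP2: for any $f:A\to tB'$ in $\mathcal M$ and $i:A\to tA'$ in $\mathcal W$: (1) there exist maps $q':S'\to A'$, $p':S'\to B'$ in $\mathcal M'$ with $q'\in\mathcal W'$ and a weak equivalence $\tau:A\to tS'$ with $tq'\circ\tau=i$, $tp'\circ\tau=f$; (2) for any other such $p'',q'',\tau''$, one has $p'q'^{-1}=p''q''^{-1}$ in $\mathbf{ho}\mathcal M'$. *)

(* Defs.v *)
From mathcomp Require Import all_boot generic_quotient.
From mathcomp Require Import boolp.

Set Implicit Arguments.
Unset Strict Implicit.
Unset Printing Implicit Defensive.

Local Open Scope quotient_scope.

Declare Scope cat_scope.
Delimit Scope cat_scope with cat.
Local Open Scope cat_scope.

Record category := Category {
  obj :> Type;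
  hom : obj -> obj -> Type;
  idc : forall A, hom A A;
  comp : forall A B C, hom B C -> hom A B -> hom A C;
  comp1c : forall A B (f : hom A B), comp (idc B) f = f;
  compc1 : forall A B (f : hom A B), comp f (idc A) = f;
  compcA : forall A B C D (h : hom C D) (g : hom B C) (f : hom A B),
    comp h (comp g f) = comp (comp h g) f
}.
Arguments idc {_} A.
Arguments comp {_ _ _ _} g f.
Notation "g ∘ f" := (comp g f) (at level 40, left associativity) : cat_scope.

Record functor (C D : category) := Functor {
  fobj :> C -> D;
  fmap : forall A B : C, hom A B -> hom (fobj A) (fobj B);
  fmap1 : forall A : C, fmap (idc A) = idc (fobj A);
  fmapM : forall (A B E : C) (g : hom B E) (f : hom A B),
    fmap (g ∘ f) = fmap g ∘ fmap f
}.
Arguments fmap {C D} F {A B} f : rename.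

Definition functor_id (C : category) : functor C C :=
  @Functor C C id (fun _ _ f => f) (fun _ => erefl) (fun _ _ _ _ _ => erefl).

Section FunctorComp.
Variables (C D E : category) (G : functor D E) (F : functor C D).

Let fc (A B : C) (f : hom A B) : hom (G (F A)) (G (F B)) := fmap G (fmap F f).

Fact functor_comp1 A : fc (idc A) = idc (G (F A)).
Proof. by rewrite /fc !fmap1. Qed.

Fact functor_compM (X Y Z : C) (g : hom Y Z) (f : hom X Y) :
  fc (g ∘ f) = fc g ∘ fc f.
Proof. by rewrite /fc !fmapM. Qed.

Definition functor_comp : functor C E :=
  @Functor C E (fun A => G (F A)) fc functor_comp1 functor_compM.

End FunctorComp.

Definition is_iso (C : category) (A B : C) (f : hom A B) : Prop :=
  exists g : hom B A, g ∘ f = idc A /\ f ∘ g = idc B.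

Definition naturally_isomorphic (C D : category) (F G : functor C D) : Prop :=
  exists eta : forall A : C, hom (F A) (G A),
    (forall (A B : C) (f : hom A B), fmap G f ∘ eta A = eta B ∘ fmap F f) /\
    (forall A : C, is_iso (eta A)).

Definition is_equivalence (C D : category) (F : functor C D) : Prop :=
  exists G : functor D C,
    naturally_isomorphic (functor_comp G F) (functor_id C) /\
    naturally_isomorphic (functor_comp F G) (functor_id D).

Record category_pair := CategoryPair {
  cp_cat :> category;
  weq : forall A B : cp_cat, hom A B -> Prop;
  weq_id : forall A : cp_cat, weq (idc A);
  weq_comp : forall (A B C : cp_cat) (g : hom B C) (f : hom A B),
    weq g -> weq f -> weq (g ∘ f)
}.
Arguments weq {_ _ _} f.

Record pair_functor (M' M : category_pair) := PairFunctor {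
  pf_functor :> functor M' M;
  pf_weq : forall (A B : M') (f : hom A B), weq f -> weq (fmap pf_functor f)
}.

(* Morphisms of ho M are formal composites of maps of M and of formal inverses
   of weak equivalences, modulo the congruence generated by the category
   axioms, the relations holding in M, and the two inverse laws. *)
Section Localization.
Variable M : category_pair.

Inductive word : M -> M -> Type :=
| wmap (A B : M) of hom A B : word A B
| winv (A B : M) (w : hom A B) of weq w : word B A
| wcomp (A B C : M) of word B C & word A B : word A C.

Inductive word_eq : forall A B : M, word A B -> word A B -> Prop :=
| we_refl A B (u : word A B) : word_eq u u
| we_sym A B (u v : word A B) : word_eq u v -> word_eq v u
| we_trans A B (u v w : word A B) : word_eq u v -> word_eq v w -> word_eq u w
| we_comp A B C (v v' : word B C) (u u' : word A B) :
    word_eq v v' -> word_eq u u' -> word_eq (wcomp v u) (wcomp v' u')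
| we_1w A B (u : word A B) : word_eq (wcomp (wmap (idc B)) u) u
| we_w1 A B (u : word A B) : word_eq (wcomp u (wmap (idc A))) u
| we_assoc A B C D (w : word C D) (v : word B C) (u : word A B) :
    word_eq (wcomp w (wcomp v u)) (wcomp (wcomp w v) u)
| we_map A B C (g : hom B C) (f : hom A B) :
    word_eq (wcomp (wmap g) (wmap f)) (wmap (g ∘ f))
| we_invl A B (w : hom A B) (Hw : weq w) :
    word_eq (wcomp (winv Hw) (wmap w)) (wmap (idc A))
| we_invr A B (w : hom A B) (Hw : weq w) :
    word_eq (wcomp (wmap w) (winv Hw)) (wmap (idc B)).

Definition word_eqb (A B : M) : rel {classic (word A B)} :=
  fun u v => `[< word_eq u v >].

Fact word_eqb_refl A B : reflexive (@word_eqb A B).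
Proof. by move=> u; apply/asboolP/we_refl. Qed.

Fact word_eqb_sym A B : symmetric (@word_eqb A B).
Proof. by move=> u v; apply/asboolP/asboolP; apply: we_sym. Qed.

Fact word_eqb_trans A B : transitive (@word_eqb A B).
Proof. by move=> v u w /asboolP uv /asboolP vw; apply/asboolP/(we_trans uv). Qed.

Canonical word_equiv A B := EquivRel (@word_eqb A B)
  (@word_eqb_refl A B) (@word_eqb_sym A B) (@word_eqb_trans A B).

Definition ho_hom (A B : M) : Type := {eq_quot (@word_eqb A B)}.

Definition ho_class (A B : M) (u : word A B) : ho_hom A B :=
  \pi_({eq_quot (@word_eqb A B)}) (u : {classic (word A B)}).

Definition ho_repr (A B : M) (x : ho_hom A B) : word A B :=
  repr (x : {eq_quot (@word_eqb A B)}).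

Lemma ho_reprK A B (x : ho_hom A B) : ho_class (ho_repr x) = x.
Proof. exact: (reprK (x : {eq_quot (@word_eqb A B)})). Qed.

Lemma ho_classP A B (u v : word A B) : ho_class u = ho_class v <-> word_eq u v.
Proof.
split; first by move/eqmodP/asboolP.
by move=> uv; apply/eqmodP/asboolP.
Qed.

Lemma ho_classK A B (u : word A B) : word_eq (ho_repr (ho_class u)) u.
Proof. by apply/ho_classP; rewrite ho_reprK. Qed.

Definition ho_id (A : M) : ho_hom A A := ho_class (wmap (idc A)).

Definition ho_comp (A B C : M) (y : ho_hom B C) (x : ho_hom A B) : ho_hom A C :=
  ho_class (wcomp (ho_repr y) (ho_repr x)).

Lemma ho_class_comp A B C (v : word B C) (u : word A B) :
  ho_comp (ho_class v) (ho_class u) = ho_class (wcomp v u).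
Proof. by apply/ho_classP/we_comp; apply: ho_classK. Qed.

Fact ho_comp1c A B (x : ho_hom A B) : ho_comp (ho_id B) x = x.
Proof.
rewrite -[x]ho_reprK ho_class_comp; apply/ho_classP/we_1w.
Qed.

Fact ho_compc1 A B (x : ho_hom A B) : ho_comp x (ho_id A) = x.
Proof.
rewrite -[x]ho_reprK ho_class_comp; apply/ho_classP/we_w1.
Qed.

Fact ho_compcA A B C D (z : ho_hom C D) (y : ho_hom B C) (x : ho_hom A B) :
  ho_comp z (ho_comp y x) = ho_comp (ho_comp z y) x.
Proof.
rewrite -[x]ho_reprK -[y]ho_reprK -[z]ho_reprK !ho_class_comp.
apply/ho_classP/we_assoc.
Qed.

Definition ho : category :=
  @Category M ho_hom ho_id ho_comp ho_comp1c ho_compc1 ho_compcA.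

Fact ho_map_comp (A B C : M) (g : hom B C) (f : hom A B) :
  ho_class (wmap (g ∘ f)) = (ho_class (wmap g) : @hom ho B C) ∘ ho_class (wmap f).
Proof. by rewrite /= ho_class_comp; apply/ho_classP/we_sym/we_map. Qed.

Definition ho_functor : functor M ho :=
  @Functor M ho id (fun A B f => ho_class (wmap f)) (fun=> erefl) ho_map_comp.

Definition ho_inv (A B : M) (w : hom A B) (Hw : weq w) : @hom ho B A :=
  ho_class (winv Hw).

Lemma ho_invl (A B : M) (w : hom A B) (Hw : weq w) :
  ho_inv Hw ∘ fmap ho_functor w = idc (A : ho).
Proof. by rewrite /= ho_class_comp; apply/ho_classP/we_invl. Qed.

Lemma ho_invr (A B : M) (w : hom A B) (Hw : weq w) :
  fmap ho_functor w ∘ ho_inv Hw = idc (B : ho).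
Proof. by rewrite /= ho_class_comp; apply/ho_classP/we_invr. Qed.

End Localization.

Definition inverts_weq (M : category_pair) (C : category) (F : functor M C) : Prop :=
  forall (A B : M) (w : hom A B), weq w -> is_iso (fmap F w).

Lemma ho_functor_inverts (M : category_pair) : inverts_weq (ho_functor M).
Proof.
by move=> A B w Hw; exists (ho_inv Hw); split; [apply: ho_invl|apply: ho_invr].
Qed.

Definition iso_inv (C : category) (A B : C) (f : hom A B) (Hf : is_iso f) :
  hom B A := projT1 (cid Hf).

Lemma iso_invl (C : category) (A B : C) (f : hom A B) (Hf : is_iso f) :
  iso_inv Hf ∘ f = idc A.
Proof. by case: (projT2 (cid Hf)). Qed.

Lemma iso_invr (C : category) (A B : C) (f : hom A B) (Hf : is_iso f) :
  f ∘ iso_inv Hf = idc B.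
Proof. by case: (projT2 (cid Hf)). Qed.

Lemma iso_inv_unique (C : category) (A B : C) (f : hom A B) (g h : hom B A) :
  g ∘ f = idc A -> f ∘ h = idc B -> g = h.
Proof. by move=> gf fh; rewrite -[g]compc1 -fh compcA gf comp1c. Qed.

(* Universal property of the localization: a functor inverting the weak
   equivalences factors uniquely through ho M. *)
Section Lift.
Variables (M : category_pair) (C : category) (F : functor M C).
Hypothesis HF : inverts_weq F.

Fixpoint word_eval (A B : M) (u : word A B) : hom (F A) (F B) :=
  match u with
  | wmap _ _ f => fmap F f
  | winv _ _ _ Hw => iso_inv (HF Hw)
  | wcomp _ _ _ v u => word_eval v ∘ word_eval u
  end.

Lemma word_eval_eq A B (u v : word A B) :
  word_eq u v -> word_eval u = word_eval v.
Proof.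
elim=> {A B u v} //=.
- by move=> A B u v w _ -> _ ->.
- by move=> A B D v v' u u' _ -> _ ->.
- by move=> A B u; rewrite fmap1 comp1c.
- by move=> A B u; rewrite fmap1 compc1.
- by move=> *; rewrite compcA.
- by move=> *; rewrite fmapM.
- by move=> *; rewrite iso_invl fmap1.
- by move=> *; rewrite iso_invr fmap1.
Qed.

Definition ho_lift_map (A B : ho M) (x : hom A B) : hom (F A) (F B) :=
  word_eval (ho_repr x).

Lemma ho_lift_class A B (u : word A B) :
  @ho_lift_map A B (ho_class u) = word_eval u.
Proof. exact/word_eval_eq/ho_classK. Qed.

Fact ho_lift1 (A : ho M) : ho_lift_map (idc A) = idc (F A).
Proof. by rewrite ho_lift_class /= fmap1. Qed.

Fact ho_liftM (A B E : ho M) (y : hom B E) (x : hom A B) :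
  ho_lift_map (y ∘ x) = ho_lift_map y ∘ ho_lift_map x.
Proof. by rewrite ho_lift_class. Qed.

Definition ho_lift : functor (ho M) C :=
  @Functor (ho M) C F ho_lift_map ho_lift1 ho_liftM.

Lemma ho_lift_fmap (A B : M) (f : hom A B) :
  fmap ho_lift (fmap (ho_functor M) f) = fmap F f.
Proof. exact: ho_lift_class. Qed.

End Lift.

Lemma functor_ext (C D : category) (F G : functor C D) (e : fobj F = fobj G) :
  (forall (A B : C) (f : hom A B),
    eq_rect (fobj F) (fun o => hom (o A) (o B)) (fmap F f) (fobj G) e
      = fmap G f) ->
  F = G.
Proof.
case: F G e => [o m m1 mM] [o' m' m1' mM'] /= e; case: _ / e m' m1' mM'.
move=> m' m1' mM' /= emm'.
have em : m = m' by apply: functional_extensionality_dep => A;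
  apply: functional_extensionality_dep => B;
  apply: functional_extensionality_dep => f.
by case: _ / em m1' mM' => m1' mM'; congr Functor; apply: Prop_irrelevance.
Qed.

Lemma ho_lift_factors (M : category_pair) (C : category) (F : functor M C)
    (HF : inverts_weq F) :
  functor_comp (ho_lift HF) (ho_functor M) = F.
Proof.
apply: (@functor_ext _ _ (functor_comp (ho_lift HF) (ho_functor M)) F erefl).
by move=> A B f; apply: ho_lift_fmap.
Qed.

Lemma ho_lift_unique (M : category_pair) (C : category) (F : functor M C)
    (HF : inverts_weq F) (G : functor (ho M) C) :
  functor_comp G (ho_functor M) = F -> G = ho_lift HF.
Proof.
move=> GF; case: _ / GF HF => HF.
apply: (@functor_ext _ _ G (ho_lift HF) erefl) => A B x.
rewrite -[x]ho_reprK -[RHS]/(ho_lift_map HF _) ho_lift_class.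
elim: (ho_repr x) => {A B x} //= [A B w Hw|A B D v <- u <-].
- apply: (@iso_inv_unique _ _ _ (fmap G (fmap (ho_functor M) w))).
    by rewrite -fmapM -fmap1; congr fmap; exact: ho_invl.
  exact: (iso_invr (HF _ _ _ Hw)).
- by rewrite -fmapM; congr fmap; rewrite -ho_class_comp.
Qed.

Section InducedFunctor.
Variables (M' M : category_pair) (t : pair_functor M' M).

Fact pair_functor_inverts : inverts_weq (functor_comp (ho_functor M) t).
Proof. by move=> A B w Hw; apply/ho_functor_inverts/pf_weq. Qed.

Definition ho_map : functor (ho M') (ho M) := ho_lift pair_functor_inverts.

End InducedFunctor.

Section Approximation.
Variables (M' M : category_pair) (t : pair_functor M' M).

Record left_factorization (A' B' : M') (B : M)
    (f : hom (t A') B) (p : hom (t B') B) := LeftFactorization {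
  lf_obj : M';
  lf_i : hom A' lf_obj;
  lf_j : hom B' lf_obj;
  lf_sigma : hom (t lf_obj) B;
  lf_weq_j : weq lf_j;
  lf_weq_sigma : weq lf_sigma;
  lf_eq_f : lf_sigma ∘ fmap t lf_i = f;
  lf_eq_p : lf_sigma ∘ fmap t lf_j = p
}.

(* j'^-1 i' in ho M' *)
Definition lf_fraction (A' B' : M') (B : M)
    (f : hom (t A') B) (p : hom (t B') B) (d : left_factorization f p) :
    @hom (ho M') A' B' :=
  ho_inv (lf_weq_j d) ∘ fmap (ho_functor M') (lf_i d).

Definition LAP1 : Prop :=
  forall A : M, exists (A' : M') (w : hom (t A') A), weq w.

Definition LAP2 : Prop :=
  forall (A' B' : M') (B : M) (f : hom (t A') B) (p : hom (t B') B), weq p ->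
  exists d1 : left_factorization f p,
  forall d2 : left_factorization f p, lf_fraction d1 = lf_fraction d2.

Definition left_approximation : Prop := LAP1 /\ LAP2.

Record right_factorization (A' B' : M') (A : M)
    (f : hom A (t B')) (i : hom A (t A')) := RightFactorization {
  rf_obj : M';
  rf_q : hom rf_obj A';
  rf_p : hom rf_obj B';
  rf_tau : hom A (t rf_obj);
  rf_weq_q : weq rf_q;
  rf_weq_tau : weq rf_tau;
  rf_eq_i : fmap t rf_q ∘ rf_tau = i;
  rf_eq_f : fmap t rf_p ∘ rf_tau = f
}.

(* p' q'^-1 in ho M' *)
Definition rf_fraction (A' B' : M') (A : M)
    (f : hom A (t B')) (i : hom A (t A')) (d : right_factorization f i) :
    @hom (ho M') A' B' :=
  fmap (ho_functor M') (rf_p d) ∘ ho_inv (rf_weq_q d).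

Definition RAP1 : Prop :=
  forall A : M, exists (A' : M') (w : hom A (t A')), weq w.

Definition RAP2 : Prop :=
  forall (A' B' : M') (A : M) (f : hom A (t B')) (i : hom A (t A')), weq i ->
  exists d1 : right_factorization f i,
  forall d2 : right_factorization f i, rf_fraction d1 = rf_fraction d2.

Definition right_approximation : Prop := RAP1 /\ RAP2.

End Approximation.

(* Main.v *)
(* For a left approximation, choose a weak equivalence [t (s A) -> A] for every
   [A].  The fraction [j'^-1 i'] of LAP2 depends only on [f : t A' -> B] and
   [p : t B' -> B], and pasting two factorizations shows that these fractions
   compose.  Hence [s] extends to a functor [M -> ho M'] inverting the weak
   equivalences, and the induced functor on [ho M] is a quasi-inverse of
   [ho_map t]: the two natural isomorphisms are the class of [t (s A) -> A] in
   [ho M], and the fraction of [t (s (t A')) -> t A'] against the identity.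
   The right case is dual. *)
From mathcomp Require Import all_boot boolp.
Require Import Defs.

Set Implicit Arguments.
Unset Strict Implicit.
Unset Printing Implicit Defensive.

Local Open Scope cat_scope.

Local Notation loc f := (fmap (ho_functor _) f).

(** * Natural isomorphisms between functors out of a localization *)

Lemma square_inv (C : category) (X X' Y Y' : C) (a : hom X Y) (a' : hom Y X)
    (b : hom X' Y') (b' : hom Y' X') (f : hom X X') (g : hom Y Y') :
  b' ∘ b = idc X' -> a ∘ a' = idc Y -> g ∘ a = b ∘ f -> f ∘ a' = b' ∘ g.
Proof.
by move=> b'b aa' ga; rewrite -[f]comp1c -b'b -(compcA b') -ga -!compcA aa' compc1.
Qed.

Lemma naturally_isomorphic_sym (C D : category) (F G : functor C D) :
  naturally_isomorphic F G -> naturally_isomorphic G F.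
Proof.
move=> [eta [nat_eta iso_eta]]; exists (fun A => iso_inv (iso_eta A)); split.
- by move=> A B f; apply: square_inv (nat_eta A B f); [exact: iso_invl|exact: iso_invr].
- by move=> A; exists (eta A); split; [exact: iso_invr|exact: iso_invl].
Qed.

(** The components live on the objects of [M], and naturality on maps of [M] extends to formal
    inverses and composites by induction on a representing word. *)
Lemma ho_naturally_isomorphic (M : category_pair) (C : category)
    (F G : functor (ho M) C) :
  naturally_isomorphic (functor_comp F (ho_functor M))
    (functor_comp G (ho_functor M)) ->
  naturally_isomorphic F G.
Proof.
move=> [eta [nat_eta iso_eta]]; exists eta; split=> // A B x.
rewrite -[x]ho_reprK; elim: (ho_repr x) => {A B x} [A B f|A B w Hw|A B E v IHv u IHu].
- exact: nat_eta.
(* The square at a formal inverse is the naturality square at [w] with its sides [F w] and [G w]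
   inverted. *)
- apply/esym; apply: (@square_inv _ _ _ _ _ (fmap F (fmap (ho_functor M) w)) _
      (fmap G (fmap (ho_functor M) w))).
  + by rewrite -fmapM -fmap1; congr fmap; exact: ho_invl.
  + by rewrite -fmapM -fmap1; congr fmap; exact: ho_invr.
  + by apply/esym; exact: nat_eta.
- rewrite -ho_class_comp (fmapM G (ho_class v : @hom (ho M) B E)).
  rewrite (fmapM F (ho_class v : @hom (ho M) B E)).
  by rewrite -compcA IHu compcA IHv -compcA.
Qed.

(** Everything can be checked before localizing: on the class of a map of [M'] or [M], the
    composites of [ho_lift HW] and [ho_map t] act as [H ∘ t] and [ho_map t ∘ H] do on the map. *)
Lemma ho_lift_quasi_inverse (M' M : category_pair) (t : pair_functor M' M)
    (H : functor M (ho M')) :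
  inverts_weq H ->
  naturally_isomorphic (functor_comp H t) (ho_functor M') ->
  naturally_isomorphic (functor_comp (ho_map t) H) (ho_functor M) ->
  is_equivalence (ho_map t).
Proof.
move=> HW [eta [nat_eta iso_eta]] [eps [nat_eps iso_eps]].
exists (ho_lift HW); split; apply: ho_naturally_isomorphic.
- exists eta; split=> // A B f.
  apply: etrans (nat_eta A B f) _; apply: (congr1 (comp (eta B))).
  rewrite -[RHS]/(fmap (ho_lift HW) (fmap (ho_map t) (fmap (ho_functor M') f))).
  by rewrite !ho_lift_fmap.
- exists eps; split=> // A B f.
  apply: etrans (nat_eps A B f) _; apply: (congr1 (comp (eps B))).
  rewrite -[RHS]/(fmap (ho_map t) (fmap (ho_lift HW) (fmap (ho_functor M) f))).
  by rewrite ho_lift_fmap.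
Qed.

Lemma ho_map_inv (M' M : category_pair) (t : pair_functor M' M)
    (A B : M') (w : hom A B) (Hw : weq w) :
  fmap (ho_map t) (ho_inv Hw) = ho_inv (pf_weq t Hw).
Proof.
apply: (@iso_inv_unique _ _ _ (loc (fmap t w))); last exact: ho_invr.
have := fmapM (ho_map t) (ho_inv Hw) (loc w).
by rewrite ho_invl fmap1 (ho_lift_fmap _ w).
Qed.

(** * Fractions for a left approximation *)

Section LeftApproximation.
Variables (M' M : category_pair) (t : pair_functor M' M).
Hypotheses (lap1 : LAP1 t) (lap2 : LAP2 t).

(** A lift to [ho M'] of the map [p^-1 f] of [ho M]; see [ho_map_lfrac]. *)
Definition lfrac (A B : M') (X : M) (f : hom (t A) X) (p : hom (t B) X)
    (Hp : weq p) : @hom (ho M') A B :=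
  lf_fraction (projT1 (cid (lap2 f Hp))).

(** By the uniqueness clause of LAP2, any convenient factorization computes the fraction. *)
Lemma lfracE (A B D : M') (X : M) (f : hom (t A) X) (p : hom (t B) X)
    (Hp : weq p) (i : hom A D) (j : hom B D) (Hj : weq j)
    (sigma : hom (t D) X) :
  weq sigma -> sigma ∘ fmap t i = f -> sigma ∘ fmap t j = p ->
  lfrac f Hp = ho_inv Hj ∘ loc i.
Proof.
move=> Hsigma si sj.
exact: (projT2 (cid (lap2 f Hp)) (LeftFactorization Hj Hsigma si sj)).
Qed.

Lemma lfrac_fmap (A B : M') (X : M) (a : hom A B) (p : hom (t B) X)
    (Hp : weq p) : lfrac (p ∘ fmap t a) Hp = loc a.
Proof.
(* Factor through [B] itself, with [i = a], [j] the identity and [sigma = p]. *)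
rewrite (lfracE Hp (weq_id B) Hp erefl) ?fmap1 ?compc1 //.
have := ho_invl (weq_id B); rewrite (fmap1 (ho_functor M')) compc1 => ->.
exact: comp1c.
Qed.

Lemma lfrac_id (A : M') (X : M) (p : hom (t A) X) (Hp : weq p) :
  lfrac p Hp = idc (A : ho M').
Proof.
by have := lfrac_fmap (idc A) Hp; rewrite fmap1 compc1 fmap1.
Qed.

(** Factor [f, p] through [D], then [g ∘ s, r] through [E]. The fractions of [g ∘ p] and [g ∘ f]
    become [l^-1 k j] and [l^-1 k i], and [j] cancels in [l^-1 k j j^-1 i]. *)
Lemma lfrac_comp (A B C : M') (X Y : M) (f : hom (t A) X) (p : hom (t B) X)
    (Hp : weq p) (g : hom X Y) (r : hom (t C) Y) (Hr : weq r) :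
  lfrac (g ∘ p) Hr ∘ lfrac f Hp = lfrac (g ∘ f) Hr.
Proof.
case: (cid (lap2 f Hp)) => -[D i j s Hj Hs si sj] _.
case: (cid (lap2 (g ∘ s) Hr)) => -[E k l u Hl Hu uk ul] _.
rewrite (lfracE Hp Hj Hs si sj).
rewrite (lfracE (i := k ∘ j) Hr Hl Hu _ ul); last first.
  by rewrite fmapM compcA uk -compcA sj.
rewrite (lfracE (i := k ∘ i) Hr Hl Hu _ ul); last first.
  by rewrite fmapM compcA uk -compcA si.
rewrite !fmapM -!compcA; congr (_ ∘ (_ ∘ _)).
by rewrite compcA ho_invr comp1c.
Qed.

Lemma lfrac_iso (A B : M') (X : M) (p : hom (t A) X) (r : hom (t B) X)
    (Hp : weq p) (Hr : weq r) : is_iso (lfrac p Hr).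
Proof.
(* Exchanging [p] and [r] inverts the fraction, by composition along the identity of [X]. *)
exists (lfrac r Hp); split.
- by have := lfrac_comp p Hr (idc X) Hp; rewrite !comp1c lfrac_id.
- by have := lfrac_comp r Hp (idc X) Hr; rewrite !comp1c lfrac_id.
Qed.

(** Since [p = s ∘ t j] and [f = s ∘ t i], the class of [t j] cancels in [p (t j)^-1 (t i)]. *)
Lemma ho_map_lfrac (A B : M') (X : M) (f : hom (t A) X) (p : hom (t B) X)
    (Hp : weq p) : loc p ∘ fmap (ho_map t) (lfrac f Hp) = loc f.
Proof.
case: (cid (lap2 f Hp)) => -[D i j s Hj Hs si sj] _.
rewrite (lfracE Hp Hj Hs si sj) fmapM ho_map_inv (ho_lift_fmap _ i).
rewrite -sj -si !fmapM compcA -(compcA _ (fmap (ho_functor M) (fmap t j))).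
by rewrite ho_invr compc1.
Qed.

Let s (A : M) : M' := projT1 (cid (lap1 A)).
Let pi (A : M) : hom (t (s A)) A := projT1 (cid (projT2 (cid (lap1 A)))).
Let pi_weq (A : M) : weq (pi A) := projT2 (cid (projT2 (cid (lap1 A)))).

(** A lift to [ho M'] of [(pi B)^-1 f (pi A)]. *)
Let rep_map (A B : M) (f : hom A B) : @hom (ho M') (s A) (s B) :=
  lfrac (f ∘ pi A) (pi_weq B).

Fact left_rep1 (A : M) : rep_map (idc A) = idc (s A : ho M').
Proof. by rewrite /rep_map comp1c lfrac_id. Qed.

Fact left_repM (A B C : M) (g : hom B C) (f : hom A B) :
  rep_map (g ∘ f) = rep_map g ∘ rep_map f.
Proof. by rewrite /rep_map lfrac_comp compcA. Qed.

Definition left_replacement : functor M (ho M') :=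
  @Functor M (ho M') s rep_map left_rep1 left_repM.

Lemma left_approximation_equivalence : is_equivalence (ho_map t).
Proof.
apply: (@ho_lift_quasi_inverse _ _ t left_replacement).
(* Here [w ∘ pi A] is a weak equivalence too, so [rep_map w] is a fraction of two weak
   equivalences. *)
- by move=> A B w Hw; apply: lfrac_iso; apply: weq_comp.
- exists (fun A => lfrac (pi (t A)) (weq_id (t A))); split.
  (* Both sides of the square equal the fraction of [fmap t a ∘ pi (t A)] against the identity of
     [t B]. *)
  + move=> A B a.
    have := lfrac_comp (pi (t A)) (weq_id (t A)) (fmap t a) (weq_id (t B)).
    rewrite (compc1 (fmap t a)) -{1}[fmap t a]comp1c lfrac_fmap => ->.
    have := lfrac_comp (fmap t a ∘ pi (t A)) (pi_weq (t B)) (idc _) (weq_id (t B)).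
    by rewrite !comp1c => E; exact: esym E.
  + by move=> A; exact: lfrac_iso (pi_weq (t A)) _.
- exists (fun A => loc (pi A)); split.
  + move=> A B f; rewrite -[RHS]/(loc (pi B) ∘ fmap (ho_map t) (rep_map f)).
    by rewrite ho_map_lfrac fmapM.
  + by move=> A; apply: ho_functor_inverts.
Qed.

End LeftApproximation.

(** * Dual fractions for a right approximation *)

Section RightApproximation.
Variables (M' M : category_pair) (t : pair_functor M' M).
Hypotheses (rap1 : RAP1 t) (rap2 : RAP2 t).

(** A lift to [ho M'] of the map [f i^-1] of [ho M]. *)
Definition rfrac (A B : M') (X : M) (f : hom X (t B)) (i : hom X (t A))
    (Hi : weq i) : @hom (ho M') A B :=
  rf_fraction (projT1 (cid (rap2 f Hi))).

Lemma rfracE (A B S : M') (X : M) (f : hom X (t B)) (i : hom X (t A))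
    (Hi : weq i) (p : hom S B) (q : hom S A) (Hq : weq q)
    (tau : hom X (t S)) :
  weq tau -> fmap t q ∘ tau = i -> fmap t p ∘ tau = f ->
  rfrac f Hi = loc p ∘ ho_inv Hq.
Proof.
move=> Htau qt pt.
exact: (projT2 (cid (rap2 f Hi)) (RightFactorization Hq Htau qt pt)).
Qed.

Lemma rfrac_fmap (A B : M') (X : M) (a : hom A B) (i : hom X (t A))
    (Hi : weq i) : rfrac (fmap t a ∘ i) Hi = loc a.
Proof.
rewrite (rfracE Hi (weq_id A) Hi _ erefl) ?fmap1 ?comp1c //.
have := ho_invr (weq_id A); rewrite (fmap1 (ho_functor M')) comp1c => ->.
exact: compc1.
Qed.

Lemma rfrac_id (A : M') (X : M) (i : hom X (t A)) (Hi : weq i) :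
  rfrac i Hi = idc (A : ho M').
Proof. by have := rfrac_fmap (idc A) Hi; rewrite fmap1 comp1c fmap1. Qed.

(** Factor [f, i] through [S], then [u ∘ g, r] through [E]; now [q] cancels in [p q^-1 q k l^-1]. *)
Lemma rfrac_comp (A B C : M') (X Y : M) (f : hom X (t B)) (i : hom X (t A))
    (Hi : weq i) (g : hom Y X) (r : hom Y (t C)) (Hr : weq r) :
  rfrac f Hi ∘ rfrac (i ∘ g) Hr = rfrac (f ∘ g) Hr.
Proof.
case: (cid (rap2 f Hi)) => -[S q p u Hq Hu qu pu] _.
case: (cid (rap2 (u ∘ g) Hr)) => -[E l k v Hl Hv lv kv] _.
rewrite (rfracE Hi Hq Hu qu pu).
rewrite (rfracE (p := q ∘ k) Hr Hl Hv lv); last first.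
  by rewrite fmapM -compcA kv compcA qu.
rewrite (rfracE (p := p ∘ k) Hr Hl Hv lv); last first.
  by rewrite fmapM -compcA kv compcA pu.
rewrite !fmapM !compcA; congr (_ ∘ _ ∘ _).
by rewrite -compcA ho_invl compc1.
Qed.

Lemma rfrac_iso (A B : M') (X : M) (i : hom X (t A)) (r : hom X (t B))
    (Hi : weq i) (Hr : weq r) : is_iso (rfrac r Hi).
Proof.
exists (rfrac i Hr); split.
- by have := rfrac_comp i Hr (idc X) Hi; rewrite !compc1 rfrac_id.
- by have := rfrac_comp r Hi (idc X) Hr; rewrite !compc1 rfrac_id.
Qed.

Lemma ho_map_rfrac (A B : M') (X : M) (f : hom X (t B)) (i : hom X (t A))
    (Hi : weq i) : fmap (ho_map t) (rfrac f Hi) ∘ loc i = loc f.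
Proof.
case: (cid (rap2 f Hi)) => -[S q p u Hq Hu qu pu] _.
rewrite (rfracE Hi Hq Hu qu pu) fmapM ho_map_inv (ho_lift_fmap _ p).
rewrite -qu -pu !fmapM -compcA (compcA (ho_inv _)).
by rewrite ho_invl comp1c.
Qed.

Let s (A : M) : M' := projT1 (cid (rap1 A)).
Let pi (A : M) : hom A (t (s A)) := projT1 (cid (projT2 (cid (rap1 A)))).
Let pi_weq (A : M) : weq (pi A) := projT2 (cid (projT2 (cid (rap1 A)))).

Let rep_map (A B : M) (f : hom A B) : @hom (ho M') (s A) (s B) :=
  rfrac (pi B ∘ f) (pi_weq A).

Fact right_rep1 (A : M) : rep_map (idc A) = idc (s A : ho M').
Proof. by rewrite /rep_map compc1 rfrac_id. Qed.

Fact right_repM (A B C : M) (g : hom B C) (f : hom A B) :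
  rep_map (g ∘ f) = rep_map g ∘ rep_map f.
Proof. by rewrite /rep_map rfrac_comp compcA. Qed.

Definition right_replacement : functor M (ho M') :=
  @Functor M (ho M') s rep_map right_rep1 right_repM.

Lemma right_approximation_equivalence : is_equivalence (ho_map t).
Proof.
apply: (@ho_lift_quasi_inverse _ _ t right_replacement);
  (* The maps [pi] now start at [A], so both natural isomorphisms are built out of the identity side
     and then reversed. *)
  [|apply: naturally_isomorphic_sym..].
- by move=> A B w Hw; apply: rfrac_iso; apply: weq_comp.
- exists (fun A => rfrac (pi (t A)) (weq_id (t A))); split.
  (* Both sides equal the fraction of [pi (t B) ∘ fmap t a] against the identity of [t A]. *)
  + move=> A B a.
    have := rfrac_comp (pi (t B)) (weq_id (t B)) (fmap t a) (weq_id (t A)).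
    rewrite comp1c -{1}[fmap t a]compc1 rfrac_fmap => ->.
    have := rfrac_comp (pi (t B) ∘ fmap t a) (pi_weq (t A)) (idc _) (weq_id (t A)).
    by rewrite !compc1.
  + by move=> A; exact: rfrac_iso _ (pi_weq (t A)).
- exists (fun A => loc (pi A)); split.
  + move=> A B f; rewrite -[LHS]/(fmap (ho_map t) (rep_map f) ∘ loc (pi A)).
    by rewrite ho_map_rfrac fmapM.
  + by move=> A; apply: ho_functor_inverts.
Qed.

End RightApproximation.

Theorem theorem5p5p1 (M' M : category_pair) (t : pair_functor M' M) :
  left_approximation t \/ right_approximation t ->
  is_equivalence (ho_map t).
Proof.
case=> -[ap1 ap2].
- exact: left_approximation_equivalence ap1 ap2.
- exact: right_approximation_equivalence ap1 ap2.
Qed.
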